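(* Let $m,n$ be integers with $0<m<n$ and $m\le n/2$. Fix $\alpha\in\mathbb H^2$ and let $\beta_M\in\mathbb H^2$ ($M>0$) lie on a fixed geodesic through $\alpha$, with $\beta_M\neq\alpha$ and $d_H(\alpha,\beta_M)\to\infty$ as $M\to\infty$. Let $F_M$ be a totally complex real binary form of degree $2n$ whose multiset of upper-half-plane roots consists of $m$ copies of $\alpha$ and $n-m$ copies of $\beta_M$. Then $F_M$ is stable, its Julia zero $P_M=\xi_{\mathcal J}(F_M)$ lies on the geodesic joining $\alpha$ and $\beta_M$, and $$d_H(P_M,\alpha)\longrightarrow\infty\qquad (M\to\infty),$$ so that $P_M$ escapes every compact subset of $\mathbb H^2$. If $m=n/2$, then $P_M$ is the hyperbolic midpoint of $\alpha$ and $\beta_M$. Consequently, for $1\le m\le n/2$ there is a compact set $K\subset\mathbb H^2$ for which no compact set $K'\subset\mathbb H^2$ contains $\xi_{\mathcal J}(F)$ for all stable, totally complex real binary forms $F$ of degree $2n$ having at least $m$ upper-half-plane roots (counted with multiplicity) in $K$.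
   Context: $\mathbb H^2=\{x+iy:y>0\}$ is the upper half-plane with hyperbolic distance $d_H$, $\cosh d_H(x+iy,u+iv)=1+\frac{(x-u)^2+(y-v)^2}{2yv}$. A real binary form of degree $2n$ is totally complex if it has no real roots (in $\mathbb P^1(\mathbb R)$); then $F(X,Z)=a_0\prod_{i=1}^n (X-\alpha_iZ)(X-\overline{\alpha_i}Z)$ with $a_0\in\mathbb R\setminus\{0\}$, and $\alpha_1,\ldots,\alpha_n\in\mathbb H^2$ are its upper-half-plane roots (with multiplicity). A form of degree $N$ is stable if none of its roots has multiplicity at least $N/2$. Julia's zero $\xi_{\mathcal J}(F)$: let $\mathbb H^3=\{z+t\mathbf{j}: z\in\mathbb C,\ t>0\}$, with $\mathbb H^2\subset\mathbb H^3$ via $x+iy\mapsto x+y\mathbf{j}$, and for $w=z+t\mathbf{j}$, $\alpha\in\mathbb C$ put $d_H(w,\alpha)=\ln\frac{|z-\alpha|^2+t^2}{t}$. For stable $F$ with all complex roots $\beta_1,\ldots,\beta_{2n}$ (with multiplicity), $\xi_{\mathcal J}(F)$ is the unique point $w\in\mathbb H^3$ minimizing $\sum_{i=1}^{2n} d_H(w,\beta_i)$; for totally complex real $F$ it lies in $\mathbb H^2$. *)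

(* Defs.v *)
(* MathComp / MathComp-Analysis *)
From HB Require Import structures.
From mathcomp Require Import all_boot all_order all_algebra.
From mathcomp Require Import all_classical all_reals all_analysis.
From mathcomp Require Import complex.
(* The notations of mpoly clash with those of MathComp-Analysis. *)
From mathcomp Require Import -(notations) mpoly.
From mathcomp Require Import ring lra.
Import numFieldNormedType.Exports.
Import Order.TTheory GRing.Theory Num.Theory.

Set Implicit Arguments.
Unset Strict Implicit.
Unset Printing Implicit Defensive.

Local Open Scope classical_set_scope.
Local Open Scope ring_scope.
Local Open Scope complex_scope.

Section Hyperbolic.
Variable R : realType.
Implicit Types (z w a b : R[i]) (L : set R[i]).

Definition H2 : set R[i] := [set z | 0 < complex.Im z].

Definition arcosh (x : R) : R := ln (x + Num.sqrt (x ^+ 2 - 1)).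

Definition coshdH z w : R :=
  1 + ((complex.Re z - complex.Re w) ^+ 2 + (complex.Im z - complex.Im w) ^+ 2)
      / (2 * complex.Im w * complex.Im z).

(* Meaningful for z, w in H2 only; see dH_ge0 and cosh_dH. *)
Definition dH z w : R := arcosh (coshdH z w).

Lemma coshdH_ge1 z w : H2 z -> H2 w -> 1 <= coshdH z w.
Proof.
rewrite /H2 /= => z0 w0; rewrite /coshdH lerDl divr_ge0 //.
  by rewrite addr_ge0 ?sqr_ge0.
by rewrite !mulr_ge0 ?ler0n ?ltW.
Qed.

Lemma dH_ge0 z w : H2 z -> H2 w -> 0 <= dH z w.
Proof.
move=> Hz Hw; have c1 := coshdH_ge1 Hz Hw.
by rewrite /dH /arcosh ln_ge0 // (le_trans c1) // lerDl sqrtr_ge0.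
Qed.

Lemma cosh_dH z w : H2 z -> H2 w ->
  (expR (dH z w) + expR (- dH z w)) / 2 = coshdH z w.
Proof.
move=> Hz Hw; have c1 := coshdH_ge1 Hz Hw.
rewrite /dH /arcosh; set c := coshdH z w in c1 *.
have sE : Num.sqrt (c ^+ 2 - 1) ^+ 2 = c ^+ 2 - 1.
  by rewrite sqr_sqrtr // subr_ge0 expr_ge1 // (le_trans ler01).
have s0 := sqrtr_ge0 (c ^+ 2 - 1).
set s := Num.sqrt _ in sE s0 *.
have p0 : 0 < c + s by lra.
rewrite expRN lnK ?posrE //.
have pn0 : c + s != 0 by rewrite gt_eqF.
have -> : (c + s)^-1 = c - s.
  apply: (mulfI pn0); rewrite divff //.
  have -> : (c + s) * (c - s) = c ^+ 2 - s ^+ 2 by ring.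
  by rewrite sE; ring.
by field.
Qed.

(* A complete geodesic is the image of an isometric embedding of the real
   line into (H2, dH). *)
Definition geodesic L : Prop :=
  exists gamma : R -> R[i],
    [/\ forall t, H2 (gamma t),
        forall s t, dH (gamma s) (gamma t) = `|s - t|
      & L = range gamma].

(* z lies on the geodesic segment from a to b. *)
Definition on_geodesic_segment a b z : Prop :=
  exists gamma : R -> R[i],
    [/\ forall t, 0 <= t <= dH a b -> H2 (gamma t),
        forall s t, 0 <= s <= dH a b -> 0 <= t <= dH a b ->
          dH (gamma s) (gamma t) = `|s - t|,
        gamma 0 = a,
        gamma (dH a b) = b
      & exists2 t, 0 <= t <= dH a b & gamma t = z].

Definition hyp_midpoint a b z : Prop :=
  [/\ H2 z, dH a z = dH a b / 2 & dH z b = dH a b / 2].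

(* R[i]^o is R[i] with the topology of its norm; since H2 is a subspace,
   compactness in H2 is compactness of a subset contained in H2. *)
Definition compact_in_H2 (K : set R[i]) : Prop :=
  compact (K : set R[i]^o) /\ K `<=` H2.

(* A pair (z, t) with 0 < t stands for z + t j. *)
Definition H3 : set (R[i] * R) := [set w | 0 < w.2].

Definition toH3 z : R[i] * R := ((complex.Re z)%:C, complex.Im z).

Definition dH3 (w : R[i] * R) a : R :=
  ln ((Normc.normc (w.1 - a) ^+ 2 + w.2 ^+ 2) / w.2).

End Hyperbolic.

(* A binary form F(X, Z) is a homogeneous element of mpoly 2 R; the variable
   of index 0 is X and that of index 1 is Z. *)
Section BinaryForms.
Variable R : realType.
Implicit Types (F : mpoly 2 R) (N : nat).

Definition pt2 (T : Type) (x z : T) : 'I_2 -> T :=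
  fun i => if i == ord0 then x else z.

Definition binary_form N F : Prop := F \is ishomog1 N mdeg /\ F != 0.

Definition totally_complex N F : Prop :=
  binary_form N F /\
  forall x z : R, (x, z) != (0, 0) -> meval (pt2 x z) F != 0.

(* The linear form z X - x Z, which vanishes at the point (x : z). *)
Definition point_form (x z : R[i]) : mpoly 2 R[i] :=
  z *: mpolyX _ (mnm1 ord0) - x *: mpolyX _ (mnm1 ord_max).

(* The point (x : z) of P^1(C) is a root of F of multiplicity at least k. *)
Definition root_mult_ge F (x z : R[i]) (k : nat) : Prop :=
  exists G : mpoly 2 R[i],
    map_mpoly (real_complex R) F = point_form x z ^+ k * G.

Definition stable N F : Prop :=
  binary_form N F /\
  forall (x z : R[i]) (k : nat), (x, z) != (0, 0) -> (0 < k)%N ->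
    root_mult_ge F x z k -> (k.*2 < N)%N.

(* F(X, 1). *)
Definition dehom F : {poly R[i]} :=
  mmap (polyC \o real_complex R) (pt2 'X 1) F.

(* The roots of F(X, 1) with multiplicity. For a form of degree N without
   real roots these are all the N complex roots of F, because (1 : 0) is not
   a root. *)
Definition complex_roots F : seq R[i] :=
  sval (closed_field_poly_normal (dehom F)).

Definition upper_roots F : seq R[i] :=
  [seq b <- complex_roots F | 0 < complex.Im b].

Definition julia_sum F (w : R[i] * R) : R :=
  \sum_(b <- complex_roots F) dH3 w b.

(* The unique minimizer of julia_sum F on H3; (0, 0), which is not in H3, if
   there is none. *)
Definition julia_zero F : R[i] * R :=
  xget (0, 0) [set w | H3 w /\
    forall w', H3 w' -> w' != w -> julia_sum F w < julia_sum F w'].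

End BinaryForms.

(* Main.v *)
Require Import Defs.
From HB Require Import structures.
From mathcomp Require Import all_boot all_order all_algebra.
From mathcomp Require Import all_classical all_reals all_analysis.
From mathcomp Require Import complex.
From mathcomp Require Import -(notations) mpoly.
From mathcomp Require Import ring lra.
Import numFieldNormedType.Exports.
Import Order.TTheory GRing.Theory Num.Theory.

Set Implicit Arguments.
Unset Strict Implicit.
Unset Printing Implicit Defensive.

Local Open Scope classical_set_scope.
Local Open Scope ring_scope.

(** Write C(z, w) for the hyperbolic cosine of the distance of z and w in the
    upper half-plane, and k = n - m.

    The roots of a totally complex real form are the upper roots and their
    conjugates (perm_complex_roots), so Julia's function is a sum over upper
    roots b of the height pairs d(w, b) + d(w, conj b).  Such a pair equals
    2 ln (2 Im b) + 2 ln C(w, b) on H2, and at a point w off H2 it is at least its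
    value at the orthogonal projection of w onto H2, strictly so unless that
    projection is b (pair_sum_ge, pair_sum_gt).  Hence the problem is to minimize
    m ln C(q, a) + k ln C(q, b) over q in H2.

    Let D = d(a, b), and let p be the point of the segment from a to b at
    distance r from a where the derivatives balance,
    m tanh r = k tanh (D - r).  In the hyperboloid model this says that the vector
    m a / C(p, a) + k b / C(p, b) - (m + k) p vanishes, so that for every q the
    ratios X = C(q, a) / C(p, a) and Y = C(q, b) / C(p, b) satisfy
    m X + k Y = (m + k) cosh s with s = d(q, p) (balance).  If q differs from p,
    both ratios lie strictly between exp (- s) and exp s, because the Gram
    determinant of three points is nonnegative (gram_ge0).  There the concave
    logarithm lies above its chord (ln_chord):
    ln X > s (X - cosh s) / sinh s.  Adding up, m ln X + k ln Y > 0; thus p is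
    the unique minimizer (balanced_minimum).

    Because m <= k, the balance point satisfies r >= D / 2, with equality when
    m = k (balance_parameter).  So it escapes as D tends to infinity, whereas
    distances to a are bounded on compact sets (compact_dH_bounded).  For the last
    assertion the compact set is {i}, and the forms
    (X^2 + Z^2)^m (X^2 + e^(2M) Z^2)^k, whose upper roots i and e^M i lie on the
    imaginary axis, realize such a family. *)

(** * Hyperbolic functions *)

Section HyperbolicTrig.
Variable R : realType.
Implicit Types x y r D : R.

Definition ch x : R := (expR x + expR (- x)) / 2.
Definition sh x : R := (expR x - expR (- x)) / 2.

Lemma ch2_sh2 x : ch x ^+ 2 - sh x ^+ 2 = 1.
Proof.
rewrite /ch /sh expRN; have : expR x != 0 by rewrite gt_eqF ?expR_gt0.
by set e := expR x => e0; field.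
Qed.

Lemma chD x y : ch (x + y) = ch x * ch y + sh x * sh y.
Proof. by rewrite /ch /sh opprD !expRD; field. Qed.

Lemma chN x : ch (- x) = ch x.
Proof. by rewrite /ch opprK addrC. Qed.

Lemma ch_gt0 x : 0 < ch x.
Proof. by rewrite /ch divr_gt0 ?addr_gt0 ?expR_gt0. Qed.

Lemma ch_inj_ge0 x y : 0 <= x -> 0 <= y -> ch x = ch y -> x = y.
Proof.
move=> x0 y0; rewrite /ch !expRN => e.
apply: expR_inj.
have a1 : 1 <= expR x by rewrite -expR0 ler_expR.
have b1 : 1 <= expR y by rewrite -expR0 ler_expR.
set a := expR x in e a1 *; set b := expR y in e b1 *.
have an0 : a != 0 by rewrite gt_eqF ?expR_gt0.
have bn0 : b != 0 by rewrite gt_eqF ?expR_gt0.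
have h : (a - b) * (a * b - 1) = 0.
  have -> : (a - b) * (a * b - 1) = 2 * a * b * ((a + a^-1) / 2 - (b + b^-1) / 2).
    by field; rewrite ?an0 ?bn0.
  by rewrite e subrr mulr0.
move/eqP: h; rewrite mulf_eq0 => /orP[/eqP|/eqP]; first by lra.
by nra.
Qed.

End HyperbolicTrig.

(** * The minimization in the upper half-plane *)

Section Plane.
Variable R : realType.
Implicit Types z w q p a b : R[i].

Lemma coshdH_ch z w : H2 z -> H2 w -> coshdH z w = ch (dH z w).
Proof. by move=> Hz Hw; rewrite -cosh_dH. Qed.

Lemma dH_eq z w (r : R) : H2 z -> H2 w -> 0 <= r -> coshdH z w = ch r ->
  dH z w = r.
Proof.
move=> Hz Hw r0; rewrite coshdH_ch //.
by apply: ch_inj_ge0 => //; exact: dH_ge0.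
Qed.

Lemma coshdH_sym z w : coshdH z w = coshdH w z.
Proof.
case: z w => [x y] [u v]; rewrite /coshdH /= (mulrAC 2).
by congr (1 + (_ + _) / _); ring.
Qed.

Lemma dH_sym z w : dH z w = dH w z.
Proof. by rewrite /dH coshdH_sym. Qed.

Lemma coshdH_gt0 z w : H2 z -> H2 w -> 0 < coshdH z w.
Proof. by move=> Hz Hw; rewrite (lt_le_trans ltr01) ?coshdH_ge1. Qed.

Lemma coshdH_gt1 z w : H2 z -> H2 w -> z != w -> 1 < coshdH z w.
Proof.
case: z w => [x y] [u v]; rewrite /H2 /coshdH /= => y0 v0 zw.
rewrite ltrDl divr_gt0 ?mulr_gt0 //.
rewrite lt_neqAle addr_ge0 ?sqr_ge0 // andbT eq_sym paddr_eq0 ?sqr_ge0 //.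
rewrite !sqrf_eq0 !subr_eq0; apply: contra zw => /andP[/eqP -> /eqP ->].
by [].
Qed.

(** The vectors (1/y, x/y, (x^2+y^2)/y) realize H2 as a sheet of a hyperboloid in
    a space of signature (1, 2), with C as the pairing; the difference of the two
    sides is the Gram determinant of three such vectors, a positive multiple of
    the square of their determinant. *)
Lemma gram_ge0 z w q : H2 z -> H2 w -> H2 q ->
  coshdH z w ^+ 2 + coshdH w q ^+ 2 + coshdH z q ^+ 2
  <= 1 + 2 * coshdH z w * coshdH w q * coshdH z q.
Proof.
case: z w q => [x1 y1] [x2 y2] [x3 y3]; rewrite /H2 /coshdH /= => p1 p2 p3.
rewrite -subr_ge0.
set X := (X in 0 <= X).
pose s x y : R := x ^+ 2 + y ^+ 2.
pose det := x1 * (s x2 y2 - s x3 y3) + x2 * (s x3 y3 - s x1 y1)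
          + x3 * (s x1 y1 - s x2 y2).
suff -> : X = (det / (2 * y1 * y2 * y3)) ^+ 2 by rewrite sqr_ge0.
by rewrite /X /det /s; field; rewrite !gt_eqF.
Qed.

(** In signature (1, 2) a vector orthogonal to a timelike vector is spacelike, so
    it vanishes as soon as it is isotropic.  The quadratic form is
    (a, b, c) |-> a c - b^2. *)
Lemma lorentz_null (a b c a0 b0 c0 : R) :
  a0 * c0 - b0 ^+ 2 = 1 -> a * c = b ^+ 2 -> a * c0 + c * a0 = 2 * b * b0 ->
  [/\ a = 0, b = 0 & c = 0].
Proof.
move=> h0 h1 h2.
have e : (a * c0 - c * a0) ^+ 2 + (2 * b) ^+ 2 = 0.
  have -> : (a * c0 - c * a0) ^+ 2 =
    (a * c0 + c * a0) ^+ 2 - 4 * (a * c) * (a0 * c0) by ring.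
  by rewrite h2 h1 (_ : a0 * c0 = 1 + b0 ^+ 2); [ring | lra].
move/eqP: e; rewrite paddr_eq0 ?sqr_ge0 // !sqrf_eq0 => /andP[/eqP e /eqP b2].
have b0' : b = 0 by lra.
rewrite b0' in h2.
have ac0 : a * c0 = 0 by lra.
have ca0 : c * a0 = 0 by lra.
have n0 : a0 * c0 != 0 by rewrite gt_eqF //; have := sqr_ge0 b0; lra.
have [an cn] : a0 != 0 /\ c0 != 0.
  by move: n0; rewrite mulf_eq0 negb_or => /andP[].
split=> //.
  by apply: (mulIf cn); rewrite ac0 mul0r.
by apply: (mulIf an); rewrite ca0 mul0r.
Qed.

(** First-order condition at p.  Here s and t stand for the hyperbolic sines of
    d(p, a) and d(p, b), and the formula for C(a, b) says that p is between a and
    b.  The vector u a + v b - (m + k) p, with u = m / C(p, a) and v = k / C(p, b),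
    is orthogonal to p, and its square is - (u s - v t)^2 = 0; by lorentz_null it
    is zero, and pairing it with q gives the claim. *)
Lemma balance a b p q (m k s t : R) : H2 a -> H2 b -> H2 p -> H2 q ->
  coshdH p a ^+ 2 - s ^+ 2 = 1 -> coshdH p b ^+ 2 - t ^+ 2 = 1 ->
  coshdH a b = coshdH p a * coshdH p b + s * t ->
  m * s * coshdH p b = k * t * coshdH p a ->
  m * (coshdH q a / coshdH p a) + k * (coshdH q b / coshdH p b)
  = (m + k) * coshdH q p.
Proof.
move=> Ha Hb Hp Hq hs ht hC hm.
have := coshdH_gt0 Hp Ha; have := coshdH_gt0 Hp Hb.
move: hs ht hC hm; set A := coshdH p a; set B := coshdH p b.
set C := coshdH a b => hs ht hC hm B0 A0.
case: a b p q => [x1 y1] [x2 y2] [x0 y0] [x y]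
  in Ha Hb Hp Hq A B C A0 B0 hs ht hC hm *.
rewrite /H2 /= in Ha Hb Hp Hq.
pose u := m / A; pose v := k / B.
have An : A != 0 by rewrite gt_eqF.
have Bn : B != 0 by rewrite gt_eqF.
have uA : u * A = m by rewrite /u divfK.
have vB : v * B = k by rewrite /v divfK.
have n1 : y1 != 0 by rewrite gt_eqF.
have n2 : y2 != 0 by rewrite gt_eqF.
have n0 : y0 != 0 by rewrite gt_eqF.
have n3 : y != 0 by rewrite gt_eqF.
have key : u ^+ 2 + v ^+ 2 + 2 * u * v * C = (m + k) ^+ 2.
  apply: (mulIf (mulf_neq0 (expf_neq0 2 An) (expf_neq0 2 Bn))).
  have -> : (u ^+ 2 + v ^+ 2 + 2 * u * v * C) * (A ^+ 2 * B ^+ 2) =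
     (u * A) ^+ 2 * B ^+ 2 + (v * B) ^+ 2 * A ^+ 2
     + 2 * (u * A) * (v * B) * A * B * C by ring.
  rewrite uA vB hC; apply/eqP; rewrite -subr_eq0; apply/eqP.
  transitivity (m ^+ 2 * B ^+ 2 * (1 - A ^+ 2) + k ^+ 2 * A ^+ 2 * (1 - B ^+ 2)
     + 2 * (m * s * B) * (k * t * A)); first by ring.
  have -> : 1 - A ^+ 2 = - s ^+ 2 by lra.
  have -> : 1 - B ^+ 2 = - t ^+ 2 by lra.
  transitivity (- (m * s * B - k * t * A) ^+ 2); first by ring.
  by rewrite hm subrr expr0n oppr0.
have [] := @lorentz_null (u / y1 + v / y2 - (m + k) / y0)
  (u * x1 / y1 + v * x2 / y2 - (m + k) * x0 / y0)
  (u * (x1 ^+ 2 + y1 ^+ 2) / y1 + v * (x2 ^+ 2 + y2 ^+ 2) / y2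
   - (m + k) * (x0 ^+ 2 + y0 ^+ 2) / y0)
  (1 / y0) (x0 / y0) ((x0 ^+ 2 + y0 ^+ 2) / y0).
- by field.
- apply/eqP; rewrite -subr_eq0; apply/eqP.
  transitivity (u ^+ 2 + v ^+ 2 + 2 * u * v * C
     + (m + k) ^+ 2 - 2 * (m + k) * (u * A + v * B)).
    by rewrite /A /B /C /coshdH /=; field; rewrite ?n0 ?n1 ?n2.
  by rewrite key uA vB; ring.
- apply/eqP; rewrite -subr_eq0; apply/eqP.
  transitivity (2 * (u * A + v * B - (m + k))).
    by rewrite /A /B /coshdH /=; field; rewrite ?n0 ?n1 ?n2.
  by rewrite uA vB; ring.
move=> W1 W2 W3; apply/eqP; rewrite -subr_eq0; apply/eqP.
set ca := coshdH _ _; set cb := coshdH _ (x2 +i* y2)%C.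
set cp := coshdH _ (x0 +i* y0)%C.
transitivity (u * ca + v * cb - (m + k) * cp).
  by rewrite /u /v; field; rewrite ?An ?Bn.
set w1 := (X in X = 0) in W1; set w2 := (X in X = 0) in W2.
set w3 := (X in X = 0) in W3.
transitivity (((x ^+ 2 + y ^+ 2) * w1 + w3 - 2 * x * w2) / (2 * y)).
  by rewrite /ca /cb /cp /w1 /w2 /w3 /coshdH /=; field; rewrite ?n0 ?n1 ?n2 ?n3.
by rewrite W1 W2 W3; ring.
Qed.

Lemma ln_tangent (x y : R) : 0 < x -> 0 < y -> y != x ->
  ln y < ln x + (y - x) / x.
Proof.
move=> x0 y0 yx.
have xn : x != 0 by rewrite gt_eqF.
have l0 : ln y - ln x != 0.
  by rewrite subr_eq0; apply: contra yx => /eqP/ln_inj ->.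
have := expR_gt1Dx l0; rewrite expRD expRN !lnK ?posrE //.
have -> : (y - x) / x = y / x - 1 by field.
by lra.
Qed.

(** With c = cosh s' and s = sinh s', the hypothesis on x says that x lies
    strictly between exp (- s') = c - s and exp s' = c + s, and the left-hand side
    is the chord of ln between these two points.  Concavity is used through the
    tangent of ln at x, evaluated at both end points. *)
Lemma ln_chord (c s x : R) : 0 < s -> c ^+ 2 - s ^+ 2 = 1 -> 0 < x -> 0 < c ->
  x ^+ 2 + 1 < 2 * c * x ->
  (x - c) / s * ln (c + s) < ln x.
Proof.
move=> s0 cs x0 c0 hx.
have cs1 : (c + s) * (c - s) = 1 by rewrite -cs; ring.
have p0 : 0 < c + s by lra.
have m0 : 0 < c - s by rewrite -(pmulr_rgt0 _ p0) cs1.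
have [h1 h2] : c - s < x /\ x < c + s.
  have : (x - (c - s)) * (x - (c + s)) < 0.
    have -> : (x - (c - s)) * (x - (c + s)) =
      x ^+ 2 + (c ^+ 2 - s ^+ 2) - 2 * c * x by ring.
    by rewrite cs; lra.
  by split; nra.
have lnm : ln (c - s) = - ln (c + s).
  rewrite -lnV ?posrE //; congr ln.
  by apply: (mulfI (lt0r_neq0 p0)); rewrite cs1 divff ?lt0r_neq0.
have t1 : ln (c + s) < ln x + (c + s - x) / x by apply: ln_tangent; rewrite ?gt_eqF.
have t2 : ln (c - s) < ln x + (c - s - x) / x by apply: ln_tangent; rewrite ?lt_eqF.
rewrite lnm in t2.
set l := ln (c + s) in t1 t2 *.
have sn : s != 0 by rewrite gt_eqF.
have xn : x != 0 by rewrite gt_eqF.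
have u1 : 0 < (x - (c - s)) / (2 * s) by rewrite divr_gt0 //; lra.
have u2 : 0 < (c + s - x) / (2 * s) by rewrite divr_gt0 //; lra.
have w1 := ltr_pM2l u1 l (ln x + (c + s - x) / x).
have w2 := ltr_pM2l u2 (- l) (ln x + (c - s - x) / x).
rewrite t1 in w1; rewrite t2 in w2.
have := ltrD w1 w2.
congr (is_true (_ < _)); first by field.
by field; rewrite sn xn.
Qed.

(** The chord bound for the two ratios has a linear right-hand side, which sums to
    zero by balance. *)
Lemma balanced_minimum a b p q (m k s t : R) : 0 < m -> 0 < k ->
  H2 a -> H2 b -> H2 p -> H2 q -> q != p ->
  coshdH p a ^+ 2 - s ^+ 2 = 1 -> coshdH p b ^+ 2 - t ^+ 2 = 1 ->
  coshdH a b = coshdH p a * coshdH p b + s * t ->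
  m * s * coshdH p b = k * t * coshdH p a ->
  m * ln (coshdH p a) + k * ln (coshdH p b)
  < m * ln (coshdH q a) + k * ln (coshdH q b).
Proof.
move=> m0 k0 Ha Hb Hp Hq qp hs ht hC hm.
have bal := balance Ha Hb Hp Hq hs ht hC hm.
have c1 := coshdH_gt1 Hq Hp qp.
set c := coshdH q p in bal c1.
pose sg := Num.sqrt (c ^+ 2 - 1).
have sg2 : c ^+ 2 - sg ^+ 2 = 1.
  by rewrite sqr_sqrtr ?subr_ge0 ?expr_ge1 // ?ltW //; [ring | lra].
have sg0 : 0 < sg by rewrite sqrtr_gt0 subr_gt0 expr_gt1 // ltW // (lt_trans ltr01).
have bound z : H2 z -> (coshdH q z / coshdH p z - c) / sg * ln (c + sg)
    < ln (coshdH q z) - ln (coshdH p z).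
  move=> Hz; set x := coshdH q z / _.
  have pz := coshdH_gt0 Hp Hz; have qz := coshdH_gt0 Hq Hz.
  rewrite -ln_div ?posrE // -/x; apply: ln_chord => //; first by rewrite divr_gt0.
    by lra.
  have g := gram_ge0 Hq Hp Hz; rewrite -/c in g.
  have e : coshdH q z = x * coshdH p z by rewrite /x divfK // gt_eqF.
  rewrite e in g.
  rewrite -(ltr_pM2l (exprn_gt0 2 pz)).
  set P := coshdH p z in g *.
  have : c ^+ 2 > 1 by rewrite expr_gt1 //; lra.
  have -> : P ^+ 2 * (x ^+ 2 + 1) = (x * P) ^+ 2 + P ^+ 2 by ring.
  have -> : P ^+ 2 * (2 * c * x) = 2 * c * P * (x * P) by ring.
  by lra.
have := bound a Ha; have := bound b Hb => /=.
rewrite -(ltr_pM2l k0) => w2; rewrite -(ltr_pM2l m0) => w1.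
move: bal w1 w2; set x := coshdH q a / _; set y := coshdH q b / _.
set l := ln _ => bal w1 w2.
have : m * ((x - c) / sg * l) + k * ((y - c) / sg * l) = 0.
  transitivity ((m * x + k * y - (m + k) * c) / sg * l); first by ring.
  by rewrite bal subrr !mul0r.
by lra.
Qed.

End Plane.

(** * The balance point on a segment *)

Section BalancePoint.
Variable R : realType.

(** By the product formulas the balance equation reads
    (m + k) sinh (2 r - D) = (k - m) sinh D, which is solved explicitly: E below is
    exp (2 r - D). *)
Lemma balance_parameter (m k D : R) : 0 < m -> m <= k -> 0 <= D ->
  exists r, [/\ D / 2 <= r, r <= D,
    m * sh r * ch (D - r) = k * sh (D - r) * ch r & m = k -> r = D / 2].
Proof.
move=> m0 mk D0; have mk0 : 0 < k + m by lra.
pose y := (k - m) / (k + m) * sh D.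
have d1 : 1 <= expR D by rewrite -expR0 ler_expR.
have shD0 : 0 <= sh D.
  by rewrite divr_ge0 // expRN subr_ge0 (le_trans _ d1) // invf_le1 // expR_gt0.
have y0 : 0 <= y by apply: mulr_ge0 => //; apply: divr_ge0; lra.
have yD : y <= sh D.
  by rewrite ler_piMl // ler_pdivrMr //; lra.
have y2 : 0 <= y ^+ 2 + 1 by rewrite addr_ge0 ?sqr_ge0.
pose E := y + Num.sqrt (y ^+ 2 + 1).
have E1 : 1 <= E.
  have : 1 <= Num.sqrt (y ^+ 2 + 1) by rewrite -{1}sqrtr1 ler_sqrt // lerDr sqr_ge0.
  by rewrite /E; lra.
have E0 : 0 < E by lra.
have En : E != 0 by rewrite gt_eqF.
have EV : E - E^-1 = 2 * y.
  have h : E * (E - 2 * y) = 1.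
    transitivity (Num.sqrt (y ^+ 2 + 1) ^+ 2 - y ^+ 2); first by rewrite /E; ring.
    by rewrite sqr_sqrtr //; ring.
  have -> : E^-1 = E - 2 * y by apply: (mulfI En); rewrite h divff.
  by ring.
have ED : E <= expR D.
  have -> : expR D = sh D + ch D by rewrite /sh /ch; field.
  rewrite lerD // -[leRHS]gtr0_norm ?ch_gt0 // -sqrtr_sqr ler_sqrt ?sqr_ge0 //.
  have -> : ch D ^+ 2 = sh D ^+ 2 + 1 by rewrite -(ch2_sh2 D); ring.
  by rewrite lerD2r ler_sqr ?nnegrE.
have lE0 : 0 <= ln E by rewrite ln_ge0.
have lED : ln E <= D by rewrite -(expRK D) ler_ln ?posrE ?expR_gt0.
exists ((D + ln E) / 2); split; [lra | lra | | ]; last first.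
  move=> mk'; suff -> : ln E = 0 by rewrite addr0.
  by rewrite /E /y mk' subrr !mul0r expr0n /= !add0r sqrtr1 ln1.
set r := (D + ln E) / 2.
have p2 : expR r ^+ 2 = expR D * E.
  rewrite expr2 -expRD (_ : r + r = D + ln E); first by rewrite expRD lnK ?posrE.
  by rewrite /r; field.
set p := expR r in p2; set d := expR D in d1 ED p2.
have pn : p != 0 by rewrite gt_eqF ?expR_gt0.
have dn : d != 0 by rewrite gt_eqF ?expR_gt0.
have E2 : E = p ^+ 2 / d by rewrite p2; field.
have s1 : sh r * ch (D - r) = (sh D + y) / 2.
  have -> : y = (E - E^-1) / 2 by rewrite EV; field.
  rewrite E2 /sh /ch opprB !expRD !expRN -/p -/d; field; rewrite ?pn ?dn //.
have s2 : sh (D - r) * ch r = (sh D - y) / 2.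
  have -> : y = (E - E^-1) / 2 by rewrite EV; field.
  rewrite E2 /sh /ch opprB !expRD !expRN -/p -/d; field; rewrite ?pn ?dn //.
rewrite -[in LHS]mulrA -[in RHS]mulrA s1 s2 /y; field.
by rewrite gt_eqF.
Qed.

End BalancePoint.

(** * From upper half-space to the upper half-plane *)

Section UpperHalfSpace.
Variable R : realType.
Implicit Types (a b p z : R[i]) (w : R[i] * R).

(** The orthogonal projection onto the totally geodesic plane H2: the geodesics
    perpendicular to it are half-circles centred on the real axis, in the planes
    where Re z is constant. *)
Definition projH2 w : R[i] :=
  (complex.Re w.1 +i* Num.sqrt (complex.Im w.1 ^+ 2 + w.2 ^+ 2))%C.

Definition pair_sum w b : R := dH3 w b + dH3 w b^*%C.

Lemma projH2_in w : H3 w -> H2 (projH2 w).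
Proof.
by move=> t0; rewrite /H2 /= sqrtr_gt0 ltr_wpDl ?sqr_ge0 ?exprn_gt0.
Qed.

Lemma projH2_toH3 p : H2 p -> projH2 (toH3 p) = p.
Proof.
case: p => x y; rewrite /H2 /projH2 /= => y0.
by rewrite expr0n /= add0r sqrtr_sqr gtr0_norm.
Qed.

Lemma toH3_projH2 w : H3 w -> complex.Im w.1 = 0 -> toH3 (projH2 w) = w.
Proof.
case: w => [[x y] t]; rewrite /H3 /toH3 /projH2 /= => t0 ->.
by rewrite expr0n /= add0r sqrtr_sqr gtr0_norm.
Qed.

Lemma toH3_inj : injective (@toH3 R).
Proof. by move=> [x y] [u v] [/= -> ->]. Qed.

(** With w = x + i y + t j and b = u + i v, the product of the two squared distances
    is ((x - u)^2 + y^2 + t^2 + v^2)^2 - 4 y^2 v^2, and the first square is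
    (2 v C)^2 (y^2 + t^2). *)
Lemma pair_sumE w b : H3 w -> H2 b ->
  pair_sum w b = ln ((2 * complex.Im b) ^+ 2 *
    (coshdH (projH2 w) b ^+ 2
     + (complex.Im w.1 / w.2) ^+ 2 * (coshdH (projH2 w) b ^+ 2 - 1))).
Proof.
case: w b => [[x y] t] [u v]; rewrite /H3 /H2 /pair_sum /dH3 /projH2 /=.
move=> t0 v0.
rewrite !sqr_sqrtr ?addr_ge0 ?sqr_ge0 //.
have t2 : 0 < t ^+ 2 by rewrite exprn_gt0.
have s2 : 0 < y ^+ 2 + t ^+ 2 by rewrite ltr_wpDl ?sqr_ge0.
set s := Num.sqrt _.
have s0 : 0 < s by rewrite sqrtr_gt0.
have sE : s ^+ 2 = y ^+ 2 + t ^+ 2 by rewrite sqr_sqrtr // ltW.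
rewrite -lnM ?posrE ?divr_gt0 // ?ltr_wpDl ?addr_ge0 ?sqr_ge0 //.
congr ln.
have yE : y ^+ 2 = s ^+ 2 - t ^+ 2 by rewrite sE addrK.
rewrite /coshdH /=.
transitivity (((((x - u) ^+ 2 + v ^+ 2 + (y ^+ 2 + t ^+ 2)) ^+ 2
   - 4 * y ^+ 2 * v ^+ 2)) / t ^+ 2); first by field; rewrite gt_eqF.
rewrite expr_div_n -sE yE; field.
by rewrite !gt_eqF.
Qed.

(** The value of pair_sum at the point q of H2. *)
Definition plane_sum b q : R :=
  2 * ln (2 * complex.Im b) + 2 * ln (coshdH q b).

Lemma plane_sumE b q : H2 b -> H2 q ->
  plane_sum b q = ln ((2 * complex.Im b) ^+ 2 * coshdH q b ^+ 2).
Proof.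
move=> Hb Hq; have c0 := coshdH_gt0 Hq Hb.
have b0 : 0 < 2 * complex.Im b by rewrite mulr_gt0.
by rewrite lnM ?posrE ?exprn_gt0 // !lnXn // /plane_sum !mulr_natl.
Qed.

Lemma pair_sum_toH3 p b : H2 p -> H2 b -> pair_sum (toH3 p) b = plane_sum b p.
Proof.
move=> Hp Hb; rewrite pair_sumE // projH2_toH3 // plane_sumE //=.
by rewrite mul0r expr0n mul0r addr0.
Qed.

Lemma pair_sum_ge w b : H3 w -> H2 b -> plane_sum b (projH2 w) <= pair_sum w b.
Proof.
move=> Hw Hb; have Hq := projH2_in Hw.
have c1 := coshdH_ge1 Hq Hb.
have c0 := coshdH_gt0 Hq Hb.
have b0 : 0 < (2 * complex.Im b) ^+ 2 by rewrite exprn_gt0 // mulr_gt0.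
have e0 : 0 <= (complex.Im w.1 / w.2) ^+ 2 * (coshdH (projH2 w) b ^+ 2 - 1).
  by rewrite mulr_ge0 ?sqr_ge0 // subr_ge0 expr_ge1 // ltW.
have p0 : 0 < coshdH (projH2 w) b ^+ 2 by rewrite exprn_gt0.
rewrite pair_sumE // plane_sumE // ler_ln ?posrE ?mulr_gt0 //; last lra.
by rewrite ler_pM2l // lerDl.
Qed.

Lemma pair_sum_gt w b : H3 w -> H2 b -> complex.Im w.1 != 0 -> projH2 w != b ->
  plane_sum b (projH2 w) < pair_sum w b.
Proof.
move=> Hw Hb y0 qb; have Hq := projH2_in Hw.
have c1 := coshdH_gt1 Hq Hb qb.
have c0 := coshdH_gt0 Hq Hb.
have b0 : 0 < (2 * complex.Im b) ^+ 2 by rewrite exprn_gt0 // mulr_gt0.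
have e0 : 0 < (complex.Im w.1 / w.2) ^+ 2 * (coshdH (projH2 w) b ^+ 2 - 1).
  apply: mulr_gt0; last by rewrite subr_gt0 expr_gt1 // ltW.
  rewrite lt_neqAle sqr_ge0 andbT eq_sym sqrf_eq0 mulf_neq0 ?invr_eq0 //.
  by rewrite gt_eqF.
have p0 : 0 < coshdH (projH2 w) b ^+ 2 by rewrite exprn_gt0.
rewrite pair_sumE // plane_sumE // ltr_ln ?posrE ?mulr_gt0 //; last lra.
by rewrite ltr_pM2l // ltrDl.
Qed.

(** If w projects to p without being p, then Im w.1 is nonzero, and p, being
    different from a or from b, makes one of the two pairs strictly larger. *)
Lemma pair_sum_minimum a b p w (m k s t : R) : 0 < m -> 0 < k -> a != b ->
  H2 a -> H2 b -> H2 p -> H3 w -> w != toH3 p ->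
  coshdH p a ^+ 2 - s ^+ 2 = 1 -> coshdH p b ^+ 2 - t ^+ 2 = 1 ->
  coshdH a b = coshdH p a * coshdH p b + s * t ->
  m * s * coshdH p b = k * t * coshdH p a ->
  m * pair_sum (toH3 p) a + k * pair_sum (toH3 p) b
  < m * pair_sum w a + k * pair_sum w b.
Proof.
move=> m0 k0 ab Ha Hb Hp Hw wp hs ht hC hm; have Hq := projH2_in Hw.
rewrite !pair_sum_toH3 //.
have ga := pair_sum_ge Hw Ha; have gb := pair_sum_ge Hw Hb.
have ga' : m * plane_sum a (projH2 w) <= m * pair_sum w a by rewrite ler_pM2l.
have gb' : k * plane_sum b (projH2 w) <= k * pair_sum w b by rewrite ler_pM2l.
have [qp|qp] := eqVneq (projH2 w) p; last first.
  have := balanced_minimum m0 k0 Ha Hb Hp Hq qp hs ht hC hm.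
  by move: ga' gb'; rewrite /plane_sum; lra.
have y0 : complex.Im w.1 != 0.
  by apply: contra wp => /eqP y0; rewrite -qp toH3_projH2.
rewrite qp in ga' gb'.
have [pa|pa] := eqVneq p a.
  have : plane_sum b (projH2 w) < pair_sum w b.
    by apply: pair_sum_gt => //; rewrite qp pa.
  by rewrite qp -(ltr_pM2l k0); lra.
have : plane_sum a (projH2 w) < pair_sum w a by apply: pair_sum_gt; rewrite // qp.
by rewrite qp -(ltr_pM2l m0); lra.
Qed.

End UpperHalfSpace.

(** * Geodesics *)

Section Segments.
Variable R : realType.
Implicit Types (a b p : R[i]) (L : set R[i]).

Lemma geodesic_segment L a b : geodesic L -> L a -> L b ->
  exists gamma : R -> R[i],
    [/\ forall t, H2 (gamma t), forall s t, dH (gamma s) (gamma t) = `|s - t|,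
        gamma 0 = a & gamma (dH a b) = b].
Proof.
case=> g [Hg iso ->] [s _ <-] [t _ <-].
have [st|ts] := leP s t.
  exists (fun u => g (s + u)); split=> // [u v||].
  - by rewrite iso; congr `|_|; ring.
  - by rewrite addr0.
  - by rewrite iso distrC ger0_norm ?subr_ge0 // addrC subrK.
exists (fun u => g (s - u)); split=> // [u v||].
- by rewrite iso distrC; congr `|_|; ring.
- by rewrite subr0.
- by rewrite iso ger0_norm ?subr_ge0 ?ltW // opprB addrC subrK.
Qed.

Lemma balanced_point L a b (m k : R) : 0 < m -> m <= k ->
  geodesic L -> L a -> L b -> H2 a -> H2 b -> a != b ->
  exists p, [/\ H2 p, on_geodesic_segment a b p, m = k -> hyp_midpoint a b p,
     dH a b / 2 <= dH p a &
     forall w, H3 w -> w != toH3 p ->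
       m * pair_sum (toH3 p) a + k * pair_sum (toH3 p) b
       < m * pair_sum w a + k * pair_sum w b].
Proof.
move=> m0 mk geo La Lb Ha Hb ab.
have [g [Hg iso g0 gD]] := geodesic_segment geo La Lb.
set D := dH a b in gD *.
have D0 : 0 <= D by exact: dH_ge0.
have [r [r1 r2 hbal hmid]] := balance_parameter m0 mk D0.
have r0 : 0 <= r by lra.
have da : dH (g r) a = r by rewrite -g0 iso subr0 ger0_norm.
have db : dH (g r) b = D - r by rewrite -gD iso distrC ger0_norm // subr_ge0.
exists (g r); split=> //.
- by exists g; split=> //; exists r => //; rewrite r0.
- move=> /hmid rD; split=> //; first by rewrite dH_sym da.
  by rewrite db -/D; lra.
- by rewrite da.
- move=> w Hw wp.
  have ca : coshdH (g r) a = ch r by rewrite coshdH_ch // da.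
  have cb : coshdH (g r) b = ch (D - r) by rewrite coshdH_ch // db.
  apply: (@pair_sum_minimum _ a b (g r) w m k (sh r) (sh (D - r))) => //.
  + by lra.
  + by rewrite ca ch2_sh2.
  + by rewrite cb ch2_sh2.
  + by rewrite coshdH_ch // ca cb -chD -/D addrC subrK.
  + by rewrite ca cb.
Qed.

End Segments.

(** * Totally complex forms with two upper roots *)

Section Forms.
Variable R : realType.
Implicit Types (F : mpoly 2 R).

Lemma mmap_ext n (A B : nzRingType) (f g : A -> B) (h l : 'I_n -> B)
    (p : mpoly n A) : f =1 g -> h =1 l -> mmap f h p = mmap g l p.
Proof.
move=> fg hl; rewrite /mmap; apply: eq_bigr => i _; rewrite fg; congr (_ * _).
by rewrite /mmap1; apply: eq_bigr => j _; rewrite hl.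
Qed.

Lemma rmorph_mmap n (A B C : nzRingType) (g : {rmorphism B -> C}) (f : A -> B)
    (h : 'I_n -> B) (p : mpoly n A) :
  g (mmap f h p) = mmap (g \o f) (g \o h) p.
Proof.
rewrite /mmap rmorph_sum; apply: eq_bigr => i _; rewrite rmorphM; congr (_ * _).
by rewrite /mmap1 rmorph_prod; apply: eq_bigr => j _; rewrite rmorphXn.
Qed.

Lemma mmap_map_mpoly n (A B : nzRingType) (C : comNzRingType)
    (phi : {rmorphism A -> B}) (f : {rmorphism B -> C}) (h : 'I_n -> C)
    (p : mpoly n A) :
  mmap f h (map_mpoly phi p) = mmap (f \o phi) h p.
Proof.
rewrite /map_mpoly (rmorph_mmap (mmap f h)); apply: mmap_ext => [c|i] /=.
  by rewrite mmapC.
by rewrite mmapX mmap1U.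
Qed.

Lemma horner_dehom F (x : R) :
  (dehom F).[(x%:C)%C] = ((meval (pt2 x 1) F)%:C)%C.
Proof.
rewrite /meval (rmorph_mmap (real_complex R)) -/(horner_eval _ _).
rewrite /dehom rmorph_mmap; apply: mmap_ext => [c|i] /=.
  by rewrite /horner_eval hornerC.
by rewrite /horner_eval /pt2; case: eqP; rewrite ?hornerX ?hornerC.
Qed.

Lemma conj_dehom F : map_poly (@conjc R) (dehom F) = dehom F.
Proof.
rewrite /dehom rmorph_mmap; apply: mmap_ext => [c|i] /=.
  by rewrite map_polyC /= oppr0.
by rewrite /pt2; case: eqP; rewrite ?map_polyX ?rmorph1.
Qed.

Lemma dehom_neq0 N F : totally_complex N F -> dehom F != 0.
Proof.
move=> [_ H]; apply/eqP => d0.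
have := horner_dehom F 0; rewrite d0 horner0 => /esym/eqP.
rewrite -(rmorph0 (real_complex R)) (inj_eq (@complexI R)).
by apply/negP/H; rewrite xpair_eqE oner_eq0 andbF.
Qed.

Lemma dehomE F :
  dehom F = lead_coef (dehom F) *: \prod_(b <- complex_roots F) ('X - b%:P).
Proof. by rewrite /complex_roots; case: closed_field_poly_normal. Qed.

(** The dehomogenization has real coefficients, and its factorization is unique. *)
Lemma perm_conj_roots N F : totally_complex N F ->
  perm_eq (map (@conjc R) (complex_roots F)) (complex_roots F).
Proof.
move=> /dehom_neq0 d0; apply: prod_XsubC_eq.
have l0 : lead_coef (dehom F) != 0 by rewrite lead_coef_eq0.
apply: (scalerI l0); rewrite -dehomE -[RHS]conj_dehom [X in map_poly _ X]dehomE.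
rewrite map_polyZ /= -lead_coef_map conj_dehom; congr (_ *: _).
by rewrite map_prod_XsubC big_map.
Qed.

Lemma root_Im_neq0 N F b : totally_complex N F -> b \in complex_roots F ->
  complex.Im b != 0.
Proof.
move=> tc bF; apply/negP => /eqP b0.
have l0 : lead_coef (dehom F) != 0 by rewrite lead_coef_eq0 (dehom_neq0 tc).
have : root (dehom F) b by rewrite dehomE rootZ // root_prod_XsubC.
case: tc => _ H; have -> : b = ((complex.Re b)%:C)%C
  by move: b0; case: (b) => x y /= ->.
rewrite /root horner_dehom -(rmorph0 (real_complex R)) (inj_eq (@complexI R)).
by apply/negP/H; rewrite xpair_eqE oner_eq0 andbF.
Qed.

Lemma perm_complex_roots N F : totally_complex N F ->
  perm_eq (complex_roots F) (upper_roots F ++ map (@conjc R) (upper_roots F)).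
Proof.
move=> tc; pose up (b : R[i]) := 0 < complex.Im b.
have := permEl (perm_filterC up (complex_roots F)).
rewrite perm_sym => /perm_trans; apply; rewrite perm_cat2l perm_sym.
apply: perm_trans (perm_filter (predC up) (perm_conj_roots tc)).
rewrite filter_map /upper_roots -/up.
rewrite (@eq_in_filter _ up (preim (@conjc R) (predC up))) //.
move=> b /(root_Im_neq0 tc); case: b => x y /= y0.
by rewrite /up /= oppr_gt0 -leNgt lt_neqAle eq_sym y0.
Qed.

Lemma julia_sum_upper N F w : totally_complex N F ->
  julia_sum F w = \sum_(b <- upper_roots F) pair_sum w b.
Proof.
move=> tc; rewrite /julia_sum (perm_big _ (perm_complex_roots tc)) big_cat big_map.
by rewrite /= -big_split.
Qed.

Lemma julia_sum_two N F w a b m k : totally_complex N F ->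
  perm_eq (upper_roots F) (nseq m a ++ nseq k b) ->
  julia_sum F w = m%:R * pair_sum w a + k%:R * pair_sum w b.
Proof.
move=> tc pe; rewrite (julia_sum_upper _ tc) (perm_big _ pe) big_cat.
by rewrite !big_nseq !iter_addr_0 !mulr_natl.
Qed.

(** A totally complex form does not vanish at (1 : 0), so its roots are all visible
    on the dehomogenization. *)
Lemma root_mult_finite N F x z k : totally_complex N F -> (0 < k)%N ->
  (x, z) != (0, 0) -> root_mult_ge F x z k ->
  (k <= count_mem (x / z)%R (complex_roots F))%N.
Proof.
move=> tc k0 xz [G hG].
have [z0|z0] := eqVneq z 0.
  have := congr1 (mmap idfun (pt2 1 0)) hG.
  rewrite mmap_map_mpoly rmorphM rmorphXn /point_form rmorphB /=.
  rewrite !mmapZ !mmapX !mmap1U /= z0 mul0r mulr0 subr0 expr0n gtn_eqF // mul0r.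
  have -> : mmap (idfun \o real_complex R) (pt2 1 0) F = ((meval (pt2 1 0) F)%:C)%C.
    rewrite /meval (rmorph_mmap (real_complex R)); apply: mmap_ext => // i.
    rewrite [RHS]/= /pt2; case: eqP => _; rewrite ?rmorph1 ?rmorph0 //.
  move=> /eqP; rewrite -(rmorph0 (real_complex R)) (inj_eq (@complexI R)) => e.
  case: tc => _ /(_ 1 0); rewrite e xpair_eqE oner_eq0 => /(_ isT) //.
have d0 := dehom_neq0 tc.
have l0 : lead_coef (dehom F) != 0 by rewrite lead_coef_eq0.
rewrite -mu_prod_XsubC mup_geq; last by rewrite monic_neq0 ?monic_prod_XsubC.
rewrite -(dvdpZr _ _ l0) -dehomE.
have -> : dehom F = (z *: 'X - x%:P) ^+ k * mmap polyC (pt2 'X 1) G.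
  have := congr1 (mmap polyC (pt2 'X 1)) hG.
  rewrite mmap_map_mpoly rmorphM rmorphXn /point_form rmorphB /dehom /= => ->.
  by rewrite !mmapZ !mmapX !mmap1U /= mulr1 mul_polyC.
rewrite dvdp_mulr //.
have -> : z *: 'X - x%:P = z *: ('X - (x / z)%:P).
  by rewrite scalerBr -mul_polyC -[in RHS]mul_polyC -polyCM mulrCA divff // mulr1.
by rewrite exprZn dvdpZr ?expf_neq0 ?dvdpp.
Qed.

Lemma conj_neq_H2 (a b : R[i]) : H2 a -> H2 b -> a != b^*%C.
Proof.
case: a b => x y [u v]; rewrite /H2 /= => y0 v0; apply/negP => /eqP [_ e].
by move: y0; rewrite e oppr_gt0 ltNge ltW.
Qed.

Lemma two_points_stable N F a b m k : totally_complex N F ->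
  perm_eq (upper_roots F) (nseq m a ++ nseq k b) -> a != b -> H2 a -> H2 b ->
  (0 < m)%N -> (0 < k)%N -> N = (m + k).*2 -> stable N F.
Proof.
move=> tc pe ab Ha Hb m0 k0 NE; split; first by case: tc.
move=> x z j xz j0 /(root_mult_finite tc j0 xz) /leq_ltn_trans lj.
rewrite NE ltn_double; apply: lj; move: (x / z) => c.
rewrite (permP (perm_complex_roots tc)) count_cat count_map.
rewrite !(permP pe) !count_cat !count_nseq /= {pe}.
have cab : a^*%C != b^*%C by rewrite (inj_eq (inv_inj (@conjcK R))).
have [aa abc] := (conj_neq_H2 Ha Ha, conj_neq_H2 Ha Hb).
have [ba bb] := (conj_neq_H2 Hb Ha, conj_neq_H2 Hb Hb).
have [<-|_] := eqVneq a c.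
  rewrite eq_sym (negPf ab) eq_sym (negPf aa) eq_sym (negPf abc) !mul0n !addn0 mul1n.
  by rewrite -addn1 leq_add2l.
have [<-|_] := eqVneq b c.
  rewrite eq_sym (negPf ba) eq_sym (negPf bb) !mul0n !addn0 mul1n add0n.
  by rewrite -add1n leq_add2r.
rewrite !mul0n !add0n.
have [<-|_] := eqVneq a^*%C c.
  by rewrite eq_sym (negPf cab) mul0n addn0 mul1n -addn1 leq_add2l.
rewrite mul0n add0n; case: eqP => _; last by rewrite mul0n addn_gt0 m0.
by rewrite mul1n -add1n leq_add2r.
Qed.

Lemma julia_zeroE F w : H3 w ->
  (forall w', H3 w' -> w' != w -> julia_sum F w < julia_sum F w') ->
  julia_zero F = w.
Proof.
move=> Hw min; apply: xget_unique => // w' [Hw' min'].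
have [//|ne] := eqVneq w' w.
have := lt_trans (min w' Hw' ne) (min' w Hw _).
by rewrite ltxx eq_sym => /(_ ne).
Qed.

Lemma two_point_form L F a b m n : (0 < m)%N -> (m < n)%N -> (m.*2 <= n)%N ->
  geodesic L -> L a -> L b -> H2 a -> H2 b -> b != a ->
  totally_complex n.*2 F ->
  perm_eq (upper_roots F) (nseq m a ++ nseq (n - m) b) ->
  exists p, [/\ [/\ stable n.*2 F, H2 p, julia_zero F = toH3 p,
        on_geodesic_segment a b p & m.*2 = n -> hyp_midpoint a b p] &
     dH a b / 2 <= dH p a].
Proof.
move=> m0 mn m2 geo La Lb Ha Hb; rewrite eq_sym => ab tc pe.
have mR : 0 < m%:R :> R by rewrite ltr0n.
have mk : m%:R <= (n - m)%:R :> R by rewrite ler_nat leq_subRL ?addnn // ltnW.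
have [p [Hp seg mid far min]] := balanced_point mR mk geo La Lb Ha Hb ab.
exists p; split=> //; split=> //.
- apply: (two_points_stable tc pe ab Ha Hb m0); first by rewrite subn_gt0.
  by rewrite subnKC // ltnW.
- apply: julia_zeroE => // w Hw wp.
  by rewrite !(julia_sum_two _ tc pe); exact: min.
- by move=> nE; apply: mid; rewrite -nE -addnn addnK.
Qed.

End Forms.

(** * Distances on compact sets *)

Section Compactness.
Variable R : realType.

(** The topology on the domain is given by balls whose radii are positive elements
    of the field of complex numbers, hence the detour by explicit neighbourhoods. *)
Lemma lipschitz_continuous (f : R[i]^o -> R^o) :
  (forall z w : R[i], `|f z - f w| <= Normc.normc (z - w)) -> continuous f.
Proof.
move=> lip z A /nbhs_ballP [e /= e0 eA].
exists (e%:C)%C; first by rewrite /= ltcR.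
move=> w /= h; apply: eA; rewrite -ball_normE /=; apply: le_lt_trans (lip _ _) _.
by move: h; rewrite normc_def ltcR; case: (z - w).
Qed.

Lemma Re_continuous : continuous (@complex.Re R : R[i]^o -> R^o).
Proof.
apply: lipschitz_continuous => -[x y] [u v] /=.
by rewrite -sqrtr_sqr ler_sqrt ?lerDl ?sqr_ge0 ?addr_ge0 ?sqr_ge0.
Qed.

Lemma Im_continuous : continuous (@complex.Im R : R[i]^o -> R^o).
Proof.
apply: lipschitz_continuous => -[x y] [u v] /=.
by rewrite -sqrtr_sqr ler_sqrt ?lerDr ?sqr_ge0 ?addr_ge0 ?sqr_ge0.
Qed.

Lemma cvg_coshdH (T : Type) (G : set_system T) (h : T -> R[i]) (a z : R[i]) :
  Filter G -> H2 a -> H2 z ->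
  (fun w => complex.Re (h w) : R^o) @ G --> (complex.Re z : R^o) ->
  (fun w => complex.Im (h w) : R^o) @ G --> (complex.Im z : R^o) ->
  (fun w => coshdH (h w) a : R^o) @ G --> (coshdH z a : R^o).
Proof.
move=> FG Ha Hz re im.
apply: (@cvgD _ (R^o)); first exact: cvg_cst.
apply: (@cvgM R).
  by apply: (@cvgD _ (R^o)); apply: (@cvgM R); apply: (@cvgB _ (R^o)) => //;
    exact: cvg_cst.
apply: (@cvgV R); first by rewrite !mulf_neq0 // gt_eqF.
by apply: (@cvgM R) => //; exact: cvg_cst.
Qed.

Lemma coshdH_continuous (a : R[i]) (z : R[i]^o) : H2 a -> H2 (z : R[i]) ->
  {for z, continuous ((fun w : R[i] => coshdH w a) : R[i]^o -> R^o)}.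
Proof.
move=> Ha Hz; apply: (@cvg_coshdH _ _ id) => //.
- exact: (@nbhs_filter (R[i]^o) z).
- exact: Re_continuous.
- exact: Im_continuous.
Qed.

(** C is bounded on the compact set, and d <= exp d <= 2 cosh d. *)
Lemma compact_dH_bounded (K : set R[i]) (a : R[i]) : compact_in_H2 K -> H2 a ->
  exists B : R, forall z, K z -> dH z a <= B.
Proof.
move=> [cK KH] Ha.
pose f : R[i]^o -> R^o := fun w => coshdH w a.
have cf : {within (K : set R[i]^o), continuous f}.
  apply: continuous_in_subspaceT => z /set_mem Kz.
  by apply: coshdH_continuous => //; exact: KH.
have /compact_bounded [M [_ hM]] := continuous_compact cf cK.
exists (2 * (M + 1)) => z Kz.
have M1 : M < M + 1 by rewrite ltrDl.
have fz : `|f z| <= M + 1 by apply: (hM _ M1); exists z.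
have Hz := KH z Kz.
have : expR (dH z a) <= 2 * ch (dH z a).
  by rewrite /ch mulrC divfK // lerDl expR_ge0.
rewrite -coshdH_ch // => h.
have := expR_ge1Dx (dH z a); have := ler_norm (f z).
by move: fz h; rewrite /f; lra.
Qed.

End Compactness.

(** * The model family on the imaginary axis *)

Section Model.
Variable R : realType.

Definition iy (c : R) : R[i] := (0 +i* c)%C.

Lemma dH_iy (s t : R) : dH (iy (expR s)) (iy (expR t)) = `|s - t|.
Proof.
apply: dH_eq; rewrite /H2 /= ?expR_gt0 //.
have -> : ch `|s - t| = ch (s - t).
  by case: (lerP 0 (s - t)) => [/ger0_norm|/ltr0_norm] ->; rewrite ?chN.
rewrite /coshdH /iy /= /ch opprB !expRD !expRN; field.
by rewrite !gt_eqF ?expR_gt0.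
Qed.

Lemma geodesic_iy : geodesic (range (fun t : R => iy (expR t))).
Proof.
exists (fun t : R => iy (expR t)); split=> //.
  by move=> t; rewrite /H2 /= expR_gt0.
exact: dH_iy.
Qed.

Definition circle_form (c : R) : mpoly 2 R :=
  mpolyX R (mnm1 ord0) ^+ 2 + c ^+ 2 *: mpolyX R (mnm1 ord_max) ^+ 2.

Definition model_form (m k : nat) (c : R) : mpoly 2 R :=
  circle_form 1 ^+ m * circle_form c ^+ k.

Lemma meval_circle_form (x z c : R) :
  meval (pt2 x z) (circle_form c) = x ^+ 2 + c ^+ 2 * z ^+ 2.
Proof.
by rewrite /circle_form mevalD mevalZ !rmorphXn /= !mevalXU /pt2 /=.
Qed.

Lemma dehom_circle_form (c : R) :
  dehom (circle_form c) = ('X - (iy c)%:P) * ('X - ((iy c)^*%C)%:P).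
Proof.
rewrite /circle_form /dehom rmorphD /= mmapZ !rmorphXn /= !mmapX !mmap1U /=.
rewrite /pt2 /= expr1n mulr1.
have -> : (0 +i* - c)%C = - iy c by apply/eqP; rewrite eq_complex /= oppr0 !eqxx.
have -> : (c%:C)%C%:P ^+ 2 = - (iy c)%:P ^+ 2 :> {poly R[i]}.
  rewrite -!polyC_exp -polyCN; congr polyC.
  by apply/eqP; rewrite eq_complex !expr2 /=; apply/andP; split; apply/eqP; ring.
by rewrite polyCN; ring.
Qed.

Lemma circle_homog (c : R) : circle_form c \is ishomog1 2 mdeg.
Proof.
have h i : (mpolyX R (mnm1 i) : mpoly 2 R) ^+ 2 \is ishomog1 2 mdeg.
  by apply: (@dhomogMn _ _ mdeg 1); rewrite dhomogX /= mdeg1.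
by apply: dhomogD => //; apply: dhomogZ.
Qed.

Lemma model_totally_complex m k c : c != 0 ->
  totally_complex (m + k).*2 (model_form m k c).
Proof.
move=> c0.
have nz x z : (x, z) != (0, 0) -> meval (pt2 x z) (model_form m k c) != 0.
  move=> xz; have pos d : d != 0 -> meval (pt2 x z) (circle_form d) != 0.
    move=> d0; rewrite meval_circle_form -exprMn gt_eqF // lt_neqAle eq_sym.
    rewrite addr_ge0 ?sqr_ge0 // andbT paddr_eq0 ?sqr_ge0 // !sqrf_eq0 mulf_eq0.
    by rewrite (negPf d0) /=.
  by rewrite mevalM !rmorphXn /= mulf_neq0 // expf_neq0 // pos // oner_neq0.
split=> //; split.
  have -> : (m + k).*2 = (2 * m + 2 * k)%N by rewrite -mulnDr mul2n.
  by apply: dhomogM; apply: dhomogMn; exact: circle_homog.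
have := nz 0 1; rewrite xpair_eqE oner_eq0 andbF => /(_ isT).
by apply: contraNneq => ->; rewrite meval0.
Qed.

Lemma dehom_model m k c : dehom (model_form m k c) =
  dehom (circle_form 1) ^+ m * dehom (circle_form c) ^+ k.
Proof. by rewrite /dehom rmorphM !rmorphXn. Qed.

Lemma upper_roots_model m k c : 0 < c ->
  perm_eq (upper_roots (model_form m k c)) (nseq m (iy 1) ++ nseq k (iy c)).
Proof.
move=> c0; pose s := nseq m (iy 1) ++ nseq k (iy c).
have prodE : dehom (model_form m k c)
    = \prod_(b <- s ++ map (@conjc R) s) ('X - b%:P).
  rewrite dehom_model !dehom_circle_form big_cat big_map !big_cat /= !big_nseq.
  by rewrite !iter_mulr_1 !exprMn mulrACA.
have pe : perm_eq (complex_roots (model_form m k c)) (s ++ map (@conjc R) s).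
  apply: prod_XsubC_eq; rewrite -prodE [RHS]dehomE.
  by rewrite prodE lead_coef_prod_XsubC scale1r.
rewrite (perm_trans (perm_filter _ pe)) // filter_cat.
have -> : [seq b <- map (@conjc R) s | 0 < complex.Im b] = [::].
  rewrite /s map_cat !map_nseq filter_cat !filter_nseq /= !oppr_gt0 ltr10.
  by rewrite ltNge ltW.
by rewrite cats0 /s filter_cat !filter_nseq /= ltr01 c0 !mul1n.
Qed.

End Model.

(** * Escape of the Julia zero *)

(** As m <= n / 2, the Julia zero is at least as far from alpha as the midpoint of
    alpha and beta M is. *)
Lemma julia_zero_escapes (R : realType) (m n : nat) :
  (0 < m)%N -> (m < n)%N -> (m.*2 <= n)%N ->
  forall (alpha : R[i]) (L : set R[i]) (beta : R -> R[i])
      (F : R -> mpoly 2 R),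
    H2 alpha -> geodesic L -> L alpha ->
    (forall M : R, 0 < M -> L (beta M) /\ beta M != alpha) ->
    dH alpha (beta M) @[M --> +oo] --> +oo ->
    (forall M : R, 0 < M -> totally_complex n.*2 (F M) /\
      perm_eq (upper_roots (F M)) (nseq m alpha ++ nseq (n - m) (beta M))) ->
    exists P : R -> R[i],
      [/\ forall M : R, 0 < M ->
            [/\ stable n.*2 (F M),
                H2 (P M),
                julia_zero (F M) = toH3 (P M),
                on_geodesic_segment alpha (beta M) (P M)
              & m.*2 = n -> hyp_midpoint alpha (beta M) (P M)],
          dH (P M) alpha @[M --> +oo] --> +oo
        & forall K' : set R[i], compact_in_H2 K' ->
            \forall M \near +oo, ~ K' (P M)].
Proof.
move=> m_gt0 m_lt_n m_le_half.
move=> a L beta F Ha geo La Lbeta dbeta HF.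
have /choice[P HP] (M : R) : exists p, 0 < M ->
    [/\ [/\ stable n.*2 (F M), H2 p, julia_zero (F M) = toH3 p,
        on_geodesic_segment a (beta M) p
      & m.*2 = n -> hyp_midpoint a (beta M) p] & dH a (beta M) / 2 <= dH p a].
  have [M0|M0] := ltP 0 M; last by exists 0.
  have [Lb ba] := Lbeta M M0; have [tc pe] := HF M M0.
  have Hb : H2 (beta M) by case: (geo) Lb => g [Hg _ ->] [t _ <-].
  have [p Hp] := two_point_form m_gt0 m_lt_n m_le_half geo La Lb Ha Hb ba tc pe.
  by exists p.
have far : dH (P M) a @[M --> +oo] --> +oo.
  apply/cvgryPge => A; move/cvgryPge/(_ (2 * A)): dbeta => dbeta.
  near=> M; have M0 : 0 < M by near: M; apply: nbhs_pinfty_gt; exact: num_real.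
  have [_ half] := HP M M0.
  have : 2 * A <= dH a (beta M) by near: M.
  by lra.
exists P; split=> //; first by move=> M /HP[].
move=> K' cK'; have [B HB] := compact_dH_bounded cK' Ha.
move/cvgryPgt/(_ B): far => far.
near=> M; move=> /HB; rewrite leNgt => /negP; apply; near: M; exact: far.
Unshelve. all: by end_near.
Qed.

Theorem mainTheorem8 (R : realType) (m n : nat)
    (m_gt0 : (0 < m)%N) (m_lt_n : (m < n)%N) (m_le_half : (m.*2 <= n)%N) :
  (forall (alpha : R[i]) (L : set R[i]) (beta : R -> R[i])
      (F : R -> mpoly 2 R),
    H2 alpha -> geodesic L -> L alpha ->
    (forall M : R, 0 < M -> L (beta M) /\ beta M != alpha) ->
    dH alpha (beta M) @[M --> +oo] --> +oo ->
    (forall M : R, 0 < M -> totally_complex n.*2 (F M) /\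
      perm_eq (upper_roots (F M)) (nseq m alpha ++ nseq (n - m) (beta M))) ->
    exists P : R -> R[i],
      [/\ forall M : R, 0 < M ->
            [/\ stable n.*2 (F M),
                H2 (P M),
                julia_zero (F M) = toH3 (P M),
                on_geodesic_segment alpha (beta M) (P M)
              & m.*2 = n -> hyp_midpoint alpha (beta M) (P M)],
          dH (P M) alpha @[M --> +oo] --> +oo
        & forall K' : set R[i], compact_in_H2 K' ->
            \forall M \near +oo, ~ K' (P M)])
  /\
  exists K : set R[i], compact_in_H2 K /\
    ~ exists K' : set R[i], compact_in_H2 K' /\
        forall F : mpoly 2 R,
          stable n.*2 F -> totally_complex n.*2 F ->
          (m <= count (fun b => b \in K) (upper_roots F))%N ->
          (@toH3 R @` K') (julia_zero F).
Proof.
have escape := @julia_zero_escapes R m n m_gt0 m_lt_n m_le_half.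
split=> //; exists [set iy 1]; split.
  by split; [exact: compact_set1 | move=> _ -> /=; rewrite /H2 /= ltr01].
case=> K' [cK' HK'].
pose beta (M : R) := iy (expR M).
pose F (M : R) := model_form m (n - m) (expR M).
have iy1 : iy 1 = iy (expR 0) :> R[i] by rewrite expR0.
have tcF M : totally_complex n.*2 (F M).
  by rewrite -{1}(subnKC (ltnW m_lt_n)); apply: model_totally_complex;
    rewrite gt_eqF ?expR_gt0.
have peF M : perm_eq (upper_roots (F M)) (nseq m (iy 1) ++ nseq (n - m) (beta M)).
  by apply: upper_roots_model; exact: expR_gt0.
have Hi : H2 (iy 1 : R[i]) by rewrite /H2 /= ltr01.
have Li : range (fun t : R => iy (expR t)) (iy 1) by exists 0 => //; rewrite expR0.
have Lbeta M : 0 < M -> range (fun t : R => iy (expR t)) (beta M) /\ beta M != iy 1.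
  move=> M0; split; first by exists M.
  by rewrite eq_complex /= eqxx /= gt_eqF // expR_gt1.
have dbeta : dH (iy 1) (beta M) @[M --> +oo] --> +oo.
  apply/cvgryPge => A; near=> M; rewrite iy1 dH_iy sub0r normrN.
  by apply: le_trans (ler_norm _); near: M; apply: nbhs_pinfty_ge; exact: num_real.
have [P [HP _ /(_ K' cK') away]] := escape _ _ beta F Hi (geodesic_iy R) Li Lbeta
  dbeta (fun M _ => conj (tcF M) (peF M)).
have [M [M0 notK]] : exists M : R, 0 < M /\ ~ K' (P M).
  have [] := @filter_ex _ (+oo : set_system R) _ _
    (filterI (nbhs_pinfty_gt (num_real (0 : R))) away).
  by move=> M [M0 nK]; exists M.
have [st HPM jz _ _] := HP M M0.
have [] := HK' (F M) st (tcF M).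
  rewrite (permP (peF M)) count_cat count_nseq (_ : _ \in _ = true)
    ?mul1n ?leq_addr //.
  exact/mem_set.
by move=> q Kq; rewrite jz => /toH3_inj qP; apply: notK; rewrite -qP.
Unshelve. all: by end_near.
Qed.
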